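(* Let $C \subset A$ be a nonempty set, and let the function $f$ be Lipschitz continuous with Lipschitz constant $L$ on an open set $V \subset X$ containing $C$. Suppose that there exists $a > 0$ such that $$\varphi(\cdot, p)^{\downarrow}_A (x) \le - a \quad \forall (x, p) \in \big\{ (y, q) \in (C \times P)_{\inf} \mid \varphi(y, \cdot)^{\downarrow}(q) \ge 0 \big\}.$$ Then the penalty function $F_{\lambda}$ is feasibility-preserving on $C$. Moreover, $\lambda_{fp}(C) \le L / a$.
   Context: Setting. $X$ and $P$ are metric spaces, $M, A \subset X$ are nonempty, $f \colon X \to \mathbb{R} \cup \{+\infty\}$, $\Omega = M \cap A$, and $f$ is assumed to attain a global minimum on $\Omega$ (with finite value). $p_0 \in P$ is fixed, and $\varphi \colon X \times P \to [0, +\infty]$ satisfies $\varphi(x, p) = 0$ iff $p = p_0$ and $x \in M$; $\operatorname{dom}\varphi = \{\varphi < +\infty\}$. $F_{\lambda}(x, p) = f(x) + \lambda \varphi(x, p)$, $\lambda \ge 0$. The product $X \times P$ carries the sum metric $d((x_1,p_1),(x_2,p_2)) = d_X(x_1,x_2)+d_P(p_1,p_2)$. Rate of steepest descent: for a function $h$ on a metric space $Z$ with values in $[-\infty, +\infty]$, a set $S \subset Z$ and $z \in S$ with $h(z)$ finite, $h^{\downarrow}_S(z) = \liminf_{y \to z,\, y \in S,\, y\neq z} \frac{h(y) - h(z)}{d(y, z)}$, and $h^{\downarrow}_S(z) = +\infty$ if $z$ is an isolated point of $S$; $h^{\downarrow} = h^{\downarrow}_Z$. Here $\varphi(\cdot,p)^{\downarrow}_A(x)$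 is the rate for $y \mapsto \varphi(y,p)$ on $X$ with respect to $A$, and $\varphi(x,\cdot)^{\downarrow}(p)$ the rate for $q \mapsto \varphi(x,q)$ on $P$. For $C \subset A$: $(C \times P)_{\inf} = \big( (C \times P) \cap \operatorname{dom} \varphi \big) \setminus ( \Omega \times \{ p_0 \} )$. Feasibility preservation: $F_\lambda$ is feasibility-preserving on $C$ if there exists $\lambda_0 \ge 0$ such that for every $\lambda \ge \lambda_0$ and every $(x,p) \in C \times P$ with $F_\lambda(x,p)$ finite, the inequality $(F_\lambda)^{\downarrow}_{A \times P}(x,p) \ge 0$ implies $x \in \Omega$ and $p = p_0$. The infimum of all such $\lambda_0$ is denoted $\lambda_{fp}(C)$. *)

(* Defs.v *)
From HB Require Import structures.
From mathcomp Require Import all_boot all_order all_algebra.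
From mathcomp Require Import all_classical all_reals all_analysis.

Set Implicit Arguments.
Unset Strict Implicit.
Unset Printing Implicit Defensive.

Import Order.TTheory GRing.Theory Num.Theory.
Local Open Scope classical_set_scope.
Local Open Scope ring_scope.

(* An alias of X * P: the library equips X * P itself with the max metric. *)
Definition l1prod (X P : Type) : Type := (X * P)%type.

Section l1prod_metric.
Context {R : realType} {X P : metricType R}.

Definition l1dist (u v : l1prod X P) : R := mdist u.1 v.1 + mdist u.2 v.2.

Fact l1distxx u : l1dist u u = 0.
Proof. by rewrite /l1dist !mdistxx addr0. Qed.

Fact l1dist_positivity u v : l1dist u v = 0 -> u = v.
Proof.
case: u v => [x p] [y q]; rewrite /l1dist /= => /eqP.
rewrite paddr_eq0 ?mdist_ge0// => /andP[/eqP/mdist_positivity xy].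
by move=> /eqP/mdist_positivity pq; rewrite xy pq.
Qed.

Fact l1dist_sym u v : l1dist u v = l1dist v u.
Proof. by rewrite /l1dist (metric_sym u.1) (metric_sym u.2). Qed.

Fact l1dist_triangle v u w : l1dist u w <= l1dist u v + l1dist v w.
Proof. by rewrite /l1dist addrACA lerD// metric_triangle. Qed.

HB.instance Definition _ := Choice.copy (l1prod X P) (X * P)%type.
HB.instance Definition _ := @isMetric.Build R (l1prod X P) l1dist
  l1distxx l1dist_positivity l1dist_sym l1dist_triangle.

End l1prod_metric.

Local Open Scope ereal_scope.

(* Only meaningful when z \in S and h z is finite. *)
Definition descent_rate {R : realType} {Z : metricType R}
    (h : Z -> \bar R) (S : set Z) (z : Z) : \bar R :=
  if `[< isolated S z >] then +oo
  else limf_einf (fun y => (h y - h z) * ((mdist y z)^-1)%:E) (within S z^').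

Definition lipschitz_with {R : realType} {Z : metricType R}
    (L : R) (V : set Z) (f : Z -> \bar R) : Prop :=
  [/\ (0 <= L)%R,
      forall x, V x -> f x \is a fin_num &
      forall x y, V x -> V y -> `|f x - f y| <= (L * mdist x y)%:E].

Definition attains_min {R : realType} {Z : Type}
    (f : Z -> \bar R) (S : set Z) : Prop :=
  exists z, [/\ S z, f z \is a fin_num & forall y, S y -> f z <= f y].

Section penalty.
Context {R : realType} {X P : metricType R}.
Variables (M A : set X) (p0 : P) (f : X -> \bar R) (phi : X -> P -> \bar R).

(* In \bar R, 0 * +oo = 0, so penalty 0 is f even where phi is infinite. *)
Definition penalty (lambda : R) (z : l1prod X P) : \bar R :=
  f z.1 + lambda%:E * phi z.1 z.2.

Definition dom : set (l1prod X P) := [set z | phi z.1 z.2 < +oo].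

Definition infeasible (C : set X) : set (l1prod X P) :=
  ((C `*` [set: P]) `&` dom) `\` ((M `&` A) `*` [set p0]).

Definition fp_threshold (C : set X) (lambda0 : R) : Prop :=
  (0 <= lambda0)%R /\
  forall lambda : R, (lambda0 <= lambda)%R ->
  forall (x : X) (p : P), C x ->
    penalty lambda (x, p) \is a fin_num ->
    0 <= descent_rate (penalty lambda) (A `*` [set: P]) (x, p) ->
    (M `&` A) x /\ p = p0.

Definition feasibility_preserving (C : set X) : Prop :=
  exists lambda0, fp_threshold C lambda0.

(* Equal to +oo when there is no threshold. *)
Definition lambda_fp (C : set X) : \bar R :=
  ereal_inf [set lambda0%:E | lambda0 in fp_threshold C].

End penalty.

(* Main.v *)
(** At an infeasible point (x, p) the penalty function has negative rate of
    descent as soon as lambda > L / a. If phi(x, .) has negative rate at p,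
    move the parameter alone: f does not change, so neither does the sign of
    the rate. Otherwise move x alone in A: phi(., p) decreases at rate at
    least a while f increases at rate at most L, giving a rate at most
    L - lambda a < 0. Hence every lambda0 > L / a is a threshold, and the
    infimum of the thresholds is at most L / a. *)

Require Import Defs.
From HB Require Import structures.
From mathcomp Require Import all_boot all_order all_algebra.
From mathcomp Require Import all_classical all_reals all_analysis.
From mathcomp Require Import ring lra.

Set Implicit Arguments.
Unset Strict Implicit.
Unset Printing Implicit Defensive.

Import Order.TTheory GRing.Theory Num.Theory.
Local Open Scope classical_set_scope.
Local Open Scope ring_scope.
Local Open Scope ereal_scope.

Section descent_rate_theory.
Context {R : realType} {Z : metricType R}.
Implicit Types (h : Z -> \bar R) (S : set Z) (z : Z) (r : R).

Lemma lte_slope h z y r : h z \is a fin_num -> y != z ->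
  ((h y - h z) * ((mdist y z)^-1)%:E < r%:E) =
  (h y < h z + (r * mdist y z)%:E).
Proof.
move=> hz yz.
by rewrite lte_pdivrMr ?mdist_gt0// lteBlDr// EFinM addeC.
Qed.

(** The liminf is a supremum of infima over punctured neighbourhoods, so the infimum of the slopes
    over the punctured ball of radius [e] is also below [r], and some slope there is. An isolated
    [z] has rate [+oo]. *)
Lemma descent_rate_lt_witness h S z r (e : R) : h z \is a fin_num ->
  descent_rate h S z < r%:E -> (0 < e)%R ->
  exists y, [/\ S y, y != z, (mdist y z < e)%R &
                h y < h z + (r * mdist y z)%:E].
Proof.
move=> hz; rewrite /descent_rate; case: asboolP => // _.
rewrite limf_einfE => rate_lt e0.
have W : within S z^' [set y | [/\ S y, y != z & (mdist y z < e)%R]].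
  rewrite /within /= /dnbhs /within /=; apply/nbhs_ballP; exists e => //= y.
  by rewrite ballEmdist /= metric_sym => zy yz Sy.
have : ereal_inf [set (h y - h z) * ((mdist y z)^-1)%:E
    | y in [set y | [/\ S y, y != z & (mdist y z < e)%R]]] < r%:E.
  by apply: le_lt_trans rate_lt; apply: ereal_sup_ubound; eexists; first exact: W.
case/ereal_inf_lt => _ [y [Sy yz zye] <-]; rewrite lte_slope// => hy.
by exists y.
Qed.

(** Every punctured neighbourhood contains a slope below [r], so each infimum is at most [r];
    passing to the supremum loses strictness. *)
Lemma descent_rate_le h S z r : h z \is a fin_num ->
  (forall e : R, (0 < e)%R -> exists y, [/\ S y, y != z, (mdist y z < e)%R &
     h y < h z + (r * mdist y z)%:E]) ->
  descent_rate h S z <= r%:E.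
Proof.
move=> hz near_z; rewrite /descent_rate; case: asboolP => [isoz|_].
  (* The default value [+oo] cannot occur: the witnesses accumulate at [z], so it is not
     isolated. *)
  case: isoz => _ [U /nbhs_ballP[e /= e0 zU] US].
  have [y [Sy /eqP yz zye _]] := near_z _ e0.
  suff : [set z] y by [].
  by rewrite -US; split=> //; apply: zU; rewrite ballEmdist /= metric_sym.
rewrite limf_einfE; apply: ge_ereal_sup => _ [U zU <-].
move: zU; rewrite /within /= /dnbhs /within /= => /nbhs_ballP[e /= e0 zU].
have [y [Sy yz zye hy]] := near_z _ e0.
apply: ge_ereal_inf; exists ((h y - h z) * ((mdist y z)^-1)%:E).
  by exists y => //; apply: zU => //; rewrite ballEmdist /= metric_sym.
by apply/ltW; rewrite lte_slope.
Qed.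

End descent_rate_theory.

Section penalty_descent.
Context {R : realType} {X P : metricType R}.
Variables (A : set X) (f : X -> \bar R) (phi : X -> P -> \bar R).
Hypothesis phi_ge0 : forall x p, 0 <= phi x p.

Lemma l1prod_mdist (u v : l1prod X P) :
  mdist u v = (mdist u.1 v.1 + mdist u.2 v.2)%R.
Proof. by []. Qed.

(** With [x] fixed the sum metric reduces to that of [P] and [f x] cancels, so slopes are just
    scaled by [lambda]. *)
Lemma penalty_rate_parameter (lambda r : R) (x : X) (p : P) :
  (0 < lambda)%R -> A x -> f x \is a fin_num -> phi x p \is a fin_num ->
  descent_rate (phi x) [set: P] p < r%:E ->
  descent_rate (penalty f phi lambda) (A `*` [set: P]) (x, p) <=
    (lambda * r)%:E.
Proof.
move=> l0 Ax fx phix rate_lt; apply: descent_rate_le.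
  by rewrite /penalty /= fin_numD fx fin_numM.
move=> e /(descent_rate_lt_witness phix rate_lt)[q [_ qp qe hq]].
exists (x, q); split=> //.
- by apply: contra_neq qp => -[].
- by rewrite l1prod_mdist mdistxx add0r.
rewrite l1prod_mdist mdistxx add0r /penalty /=.
case: (f x) fx => // u _; case: (phi x p) phix hq => // v _.
case: (phi x q) (phi_ge0 x q) => // w _.
by rewrite -!EFinM -!EFinD !lte_fin; nra.
Qed.

Lemma penalty_rate_point (lambda L r : R) (V : set X) (x : X) (p : P) :
  (0 < lambda)%R -> open V -> V x -> lipschitz_with L V f ->
  phi x p \is a fin_num ->
  descent_rate (phi ^~ p) A x < r%:E ->
  descent_rate (penalty f phi lambda) (A `*` [set: P]) (x, p) <=
    (L + lambda * r)%:E.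
Proof.
move=> l0 Vo Vx [_ f_fin f_lip] phix rate_lt; have fx := f_fin _ Vx.
apply: descent_rate_le; first by rewrite /penalty /= fin_numD fx fin_numM.
move=> e e0.
have /nbhs_ballP[d /= d0 dV] : nbhs x V by apply: open_nbhs_nbhs.
(* The radius [d] keeps the witness in [V], where the Lipschitz bound holds. *)
have ed0 : (0 < Num.min e d)%R by rewrite lt_min e0.
have [y [Ay yx]] := descent_rate_lt_witness phix rate_lt ed0.
rewrite lt_min => /andP[ye yd] hy.
have Vy : V y by apply: dV; rewrite ballEmdist /= metric_sym.
exists (y, p); split=> //.
- by apply: contra_neq yx => -[].
- by rewrite l1prod_mdist mdistxx addr0.
rewrite l1prod_mdist mdistxx addr0 /penalty /=.
have := f_lip _ _ Vy Vx; have := f_fin _ Vy; case: (f y) => // u' _.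
case: (f x) fx => // u _; case: (phi x p) phix hy => // v _.
case: (phi y p) (phi_ge0 y p) => // w _.
rewrite -!EFinM -!EFinD !lte_fin lee_fin => hy /(le_trans (ler_norm _)).
by nra.
Qed.

End penalty_descent.

(** The rate may be [-oo], while the rate estimates need a real upper bound that is still
    negative. *)
Lemma lte0_EFin_between (R : realType) (x : \bar R) :
  x < 0 -> exists2 r : R, (r < 0)%R & x < r%:E.
Proof.
case: x => [x| |] //; last by exists (-1)%R; rewrite ?ltrN10 ?ltNyr.
by rewrite lte_fin => x0; exists (x / 2)%R; rewrite ?lte_fin; lra.
Qed.

Lemma fp_threshold_gt (R : realType) (X P : metricType R) (M A : set X)
    (p0 : P) (f : X -> \bar R) (phi : X -> P -> \bar R)
    (C V : set X) (L a lambda0 : R) :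
  (forall x p, 0 <= phi x p) -> C `<=` A -> open V -> C `<=` V ->
  lipschitz_with L V f -> (0 < a)%R ->
  (forall (x : X) (p : P),
     infeasible M A p0 phi C (x, p) ->
     0 <= descent_rate (phi x) [set: P] p ->
     descent_rate (phi ^~ p) A x <= (- a)%:E) ->
  (L / a < lambda0)%R -> fp_threshold M A p0 f phi C lambda0.
Proof.
move=> phi_ge0 CA V_open CV f_lip a_gt0 phi_rate lt_lambda0.
have L0 : (0 <= L)%R by case: f_lip.
split=> [|lambda lambda0_le x p Cx F_fin].
  by apply/ltW; apply: le_lt_trans lt_lambda0; rewrite divr_ge0// ltW.
have l_gt : (L / a < lambda)%R by apply: lt_le_trans lambda0_le.
(* The strict bound gives positivity even when [L] is zero. Then [lambda * +oo] is [+oo], so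
   finiteness of the penalty forces [phi x p] to be finite. *)
have l0 : (0 < lambda)%R by apply: le_lt_trans l_gt; rewrite divr_ge0// ltW.
have fx : f x \is a fin_num by case: f_lip => _ + _; apply; exact: CV.
have phix : phi x p \is a fin_num.
  have := phi_ge0 x p; move: F_fin; rewrite /penalty /= fin_numD fx /=.
  by case: (phi x p) => //; rewrite gt0_muley.
move=> F_rate; apply: contrapT => notOmega; move: F_rate; apply/negP.
rewrite -ltNge; have [rate_ge0|rate_lt0] := leP 0 (descent_rate (phi x) setT p).
- have inf_xp : infeasible M A p0 phi C (x, p).
    split; last exact: notOmega.
    by split; [split|rewrite /dom /= ltey_eq phix].
  have La : (L < lambda * a)%R by rewrite -ltr_pdivrMr.
  (* The midpoint of [- a] and [- L / lambda]: strictly above the rate of [phi], yet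
     [L + lambda * r] equals [(L - lambda * a) / 2], which is negative. *)
  pose r := (- (a + L / lambda) / 2)%R.
  have lr : (lambda * r = - (lambda * a + L) / 2)%R.
    by rewrite /r; field; rewrite gt_eqF.
  have ar : (- a < r)%R by rewrite -(ltr_pM2l l0) lr; lra.
  have rate_lt := le_lt_trans (phi_rate _ _ inf_xp rate_ge0)
    (ar : (- a)%:E < r%:E).
  apply: le_lt_trans (penalty_rate_point phi_ge0 l0 V_open (CV _ Cx) f_lip
    phix rate_lt) _.
  by rewrite lte_fin lr; lra.
- have [r r0 rate_lt] := lte0_EFin_between rate_lt0.
  apply: le_lt_trans (penalty_rate_parameter phi_ge0 l0 (CA _ Cx) fx phix
    rate_lt) _.
  by rewrite lte_fin pmulr_rlt0.
Qed.

Theorem proposition3p14 (R : realType) (X P : metricType R) (M A : set X)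
    (p0 : P) (f : X -> \bar R) (phi : X -> P -> \bar R)
    (M_neq0 : M !=set0) (A_neq0 : A !=set0)
    (f_neqNy : forall x, f x != -oo)
    (f_min : attains_min f (M `&` A))
    (phi_ge0 : forall x p, 0 <= phi x p)
    (phi_eq0 : forall x p, phi x p = 0 <-> (p = p0 /\ M x))
    (C : set X) (C_neq0 : C !=set0) (CA : C `<=` A)
    (L : R) (V : set X) (V_open : open V) (CV : C `<=` V)
    (f_lip : lipschitz_with L V f)
    (a : R) (a_gt0 : (0 < a)%R)
    (phi_rate : forall (x : X) (p : P),
       infeasible M A p0 phi C (x, p) ->
       0 <= descent_rate (phi x) [set: P] p ->
       descent_rate (fun y => phi y p) A x <= (- a)%:E) :
  feasibility_preserving M A p0 f phi C /\
  lambda_fp M A p0 f phi C <= (L / a)%:E.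
Proof.
have thr lambda0 := @fp_threshold_gt _ _ _ M A p0 f phi C V L a lambda0
  phi_ge0 CA V_open CV f_lip a_gt0 phi_rate.
split; first by exists (L / a + 1)%R; apply: thr; rewrite ltrDl.
(* Only values strictly above [L / a] are known to be thresholds, so the infimum is bounded by
   [L / a + e] for each positive [e]. *)
apply/lee_addgt0Pr => e e0; apply: ereal_inf_lbound.
by exists (L / a + e)%R => //; apply: thr; rewrite ltrDl.
Qed.
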